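(* Let $f_1=f_1(\mathbf q,\dot{\mathbf q},t)$ be twice continuously differentiable on $\mathbb R^N\times\mathbb R^N\times[0,1]$, let $A:\mathbb R^N\times[0,1]\to\mathbb R^{P\times N}$ be twice continuously differentiable, and let $W\in\mathbb R^{P\times P}$ be a constant symmetric positive definite matrix. Define $$J_1[\mathbf q]=\int_0^1 f_1(\mathbf q,\dot{\mathbf q},t)\,dt,\qquad J_2[\boldsymbol\theta,\mathbf q]=\int_0^1 f_2\,dt,\qquad f_2=f_1(\mathbf q,\dot{\mathbf q},t)+\tfrac12\big\|\dot{\boldsymbol\theta}-A(\mathbf q,t)\dot{\mathbf q}\big\|_W^2 .$$ Let $\mathbf q^*$ be an extremal of $J_1$ (a solution of its Euler–Lagrange equations) that globally minimizes $J_1$ subject to prescribed values of $\mathbf q(0)$ and $\mathbf q(1)$. Suppose one of the following holds: (1) $A(\mathbf q,t)=A_0$ is constant; in this case, for $\mathbf a,\mathbf b\in\mathbb R^P$, put $$\boldsymbol\theta^*(t\,|\,\mathbf a,\mathbf b)=\mathbf a t+\mathbf b+A_0\big(\mathbf q^*(t)-\mathbf q^*(0)\big);$$ (2) $N=1$ and $A(q,t)=\mathbf a_1(q)\in\mathbb R^{P\times 1}$ does not depend on $t$ (with $q$ scalar, and $q^*$ written for $\mathbf q^*$); in this case, for $\mathbf a,\mathbf b\in\mathbb R^P$, put $$\boldsymbol\theta^*(t\,|\,\mathbf a,\mathbf b)=\mathbf a t+\mathbf b+\int_0^t\mathbf a_1(q^*(s))\,\dot q^*(s)\,ds .$$ Then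 $(\mathbf q^*,\boldsymbol\theta^*(\cdot\,|\,\mathbf a,\mathbf b))$ satisfies the Euler–Lagrange equations of $J_2$ in the variables $(\mathbf q,\boldsymbol\theta)$ for all $\mathbf a,\mathbf b$; for any prescribed values of $\boldsymbol\theta(0)$ and $\boldsymbol\theta(1)$ the vectors $\mathbf a,\mathbf b$ can be chosen so that $\boldsymbol\theta^*(\cdot\,|\,\mathbf a,\mathbf b)$ attains them; and $(\mathbf q^*,\boldsymbol\theta^*(\cdot\,|\,\mathbf a,\mathbf b))$ is a global minimizer of $J_2$ among trajectories $(\mathbf q,\boldsymbol\theta)$ with the same values of $\mathbf q(0),\mathbf q(1),\boldsymbol\theta(0),\boldsymbol\theta(1)$.
   Context: Trajectories are $\mathbf q:[0,1]\to\mathbb R^N$ and $\boldsymbol\theta:[0,1]\to\mathbb R^P$, taken to be twice continuously differentiable, and dots denote $d/dt$. For a column vector (or matrix) $B$, $\|B\|_W^2=\mathrm{tr}(B^TWB)$. The Euler–Lagrange equations of a functional $\int_0^1 f(\mathbf y,\dot{\mathbf y},t)\,dt$ are $\frac{d}{dt}\frac{\partial f}{\partial\dot y_i}-\frac{\partial f}{\partial y_i}=0$ for all $i$. *)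

(* Defs.v *)
From HB Require Import structures.
From mathcomp Require Import all_boot all_order all_algebra.
From mathcomp Require Import all_classical all_reals all_analysis.
Set Implicit Arguments.
Unset Strict Implicit.
Unset Printing Implicit Defensive.
Import Order.TTheory GRing.Theory Num.Theory.
Import numFieldNormedType.Exports.
Local Open Scope classical_set_scope.
Local Open Scope ring_scope.

Section DerivativesInASet.
Context {R : realType} {V W : normedModType R}.
Implicit Types (S : set V) (f : V -> W).

(* Analogue of ['D_v f a] in which only the increments [h *: v + a] lying in
   [S] are considered: it is one-sided at a boundary point of [S]. *)
Definition quotient_in S f (a v : V) : set_system W :=
  h^-1 *: (f (h *: v + a) - f a) @[h --> within [set h | S (h *: v + a)] 0^'].

Definition derivable_in S f a v : Prop := cvg (quotient_in S f a v).

Definition derive_in S f a v : W := lim (quotient_in S f a v).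

(* Values of [f] outside [S] are irrelevant. *)
Fixpoint Ck_in (k : nat) S f : Prop :=
  {within S, continuous f} /\
  (if k is k'.+1 then
     forall v, (forall a, S a -> derivable_in S f a v) /\
               Ck_in k' S (fun a => derive_in S f a v)
   else True).

End DerivativesInASet.

Section Trajectories.
Context {R : realType}.

Definition I01 : set R^o := `[0, 1]%classic.

Definition trajectory n (y : R -> 'cV[R]_n) : Prop :=
  Ck_in 2 I01 (y : R^o -> 'cV[R]_n).

Definition dot n (y : R -> 'cV[R]_n) (t : R) : 'cV[R]_n :=
  derive_in I01 (y : R^o -> 'cV[R]_n) t 1.

Definition vintegral n (g : R -> 'cV[R]_n) (a b : R) : 'cV[R]_n :=
  \col_i \int[lebesgue_measure]_(s in `[a, b]) g s i ord0.

Definition functional n (f : 'cV[R]_n -> 'cV[R]_n -> R -> R)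
    (y : R -> 'cV[R]_n) : R :=
  \int[lebesgue_measure]_(t in `[0, 1]) f (y t) (dot y t) t.

Definition ei n (i : 'I_n) : 'cV[R]_n := delta_mx i ord0.

Definition partial_pos n (f : 'cV[R]_n -> 'cV[R]_n -> R -> R) (i : 'I_n)
    (x v : 'cV[R]_n) (t : R) : R :=
  'D_(ei i) (fun x' => f x' v t : R^o) x.

Definition partial_vel n (f : 'cV[R]_n -> 'cV[R]_n -> R -> R) (i : 'I_n)
    (x v : 'cV[R]_n) (t : R) : R :=
  'D_(ei i) (fun v' => f x v' t : R^o) v.

(* Derivatives are total functions, so their existence is asserted as well. *)
Definition euler_lagrange n (f : 'cV[R]_n -> 'cV[R]_n -> R -> R)
    (y : R -> 'cV[R]_n) : Prop :=
  forall (i : 'I_n) (t : R), 0 <= t <= 1 ->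
  let p : R^o -> R^o := fun s => partial_vel f i (y s) (dot y s) s in
  [/\ derivable (fun x => f x (dot y t) t : R^o) (y t) (ei i),
      derivable (fun v => f (y t) v t : R^o) (dot y t) (ei i),
      derivable_in I01 p t 1
    & derive_in I01 p t 1 - partial_pos f i (y t) (dot y t) t = 0].

Definition global_minimizer n (f : 'cV[R]_n -> 'cV[R]_n -> R -> R)
    (y : R -> 'cV[R]_n) : Prop :=
  trajectory y /\
  forall z : R -> 'cV[R]_n, trajectory z -> z 0 = y 0 -> z 1 = y 1 ->
    functional f y <= functional f z.

Definition C2_lagrangian n (f : 'cV[R]_n -> 'cV[R]_n -> R -> R) : Prop :=
  Ck_in 2 [set p : 'cV[R]_n * 'cV[R]_n * R^o | 0 <= p.2 <= 1]
    (fun p => f p.1.1 p.1.2 p.2 : R^o).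

Definition C2_matrix_field m n (A : 'cV[R]_n -> R -> 'M[R]_(m, n)) : Prop :=
  Ck_in 2 [set p : 'cV[R]_n * R^o | 0 <= p.2 <= 1] (fun p => A p.1 p.2).

Definition sym_posdef n (W : 'M[R]_n) : Prop :=
  W^T = W /\ forall x : 'cV[R]_n, x != 0 -> 0 < (x^T *m W *m x) ord0 ord0.

Definition normsqW m n (W : 'M[R]_m) (B : 'M[R]_(m, n)) : R :=
  \tr (B^T *m W *m B).

(* The pair (q, theta) is encoded as the stacked vector [col_mx q theta]. *)
Definition f2 N P (f1 : 'cV[R]_N -> 'cV[R]_N -> R -> R)
    (A : 'cV[R]_N -> R -> 'M[R]_(P, N)) (W : 'M[R]_P)
    (y v : 'cV[R]_(N + P)) (t : R) : R :=
  let q := usubmx y in let dq := usubmx v in let dtheta := dsubmx v in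
  f1 q dq t + 2^-1 * normsqW W (dtheta - A q t *m dq).

Definition theta_const N P (A0 : 'M[R]_(P, N)) (q : R -> 'cV[R]_N)
    (a b : 'cV[R]_P) (t : R) : 'cV[R]_P :=
  t *: a + b + A0 *m (q t - q 0).

(* Used for N = 1, where [i] is the only index and [q t i ord0] the scalar
   trajectory. *)
Definition theta_scalar N P (i : 'I_N) (a1 : R -> 'cV[R]_P)
    (q : R -> 'cV[R]_N) (a b : 'cV[R]_P) (t : R) : 'cV[R]_P :=
  t *: a + b + vintegral (fun s => dot q s i ord0 *: a1 (q s i ord0)) 0 t.

End Trajectories.

(* Main.v *)
Require Import Defs.
From mathcomp Require Import all_boot all_order all_algebra.
From mathcomp Require Import all_classical all_reals all_analysis.
From mathcomp Require Import ring lra.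
Set Implicit Arguments.
Unset Strict Implicit.
Unset Printing Implicit Defensive.
Import Order.TTheory GRing.Theory Num.Theory.
Import numFieldNormedType.Exports.
Local Open Scope classical_set_scope.
Local Open Scope ring_scope.

(** The residual theta' - A(q, t) q' of the path (q, theta) is the constant
    vector a.  This single fact drives both conclusions.

    What the two cases have in common is a potential: a map G from positions to
    R^P with (G(x))' = A(x, t) x' along every trajectory x, so that
    theta = a t + b + G(q) - G(q(0)).  In case (1), G(x) = A0 x; in case (2),
    each coordinate of G is an antiderivative of a coordinate of a1, and the
    integral in theta is computed by the fundamental theorem of calculus
    ([const_potential], [scalar_potential]).  Hence theta attains any boundary
    values, and the integral of the residual z' - A(x, t) x' of a competitor
    (x, z) depends only on its endpoints: it is always a.  Below, <_, _> and |_|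
    are the inner product and the norm given by W.

    Minimality.  By convexity of the weighted norm, |u|^2 is at least
    |a|^2 + 2 <a, u - a>, where u is the residual of the competitor.  The cross
    term integrates to zero by the above, so the quadratic part of the
    functional is at least |a|^2 / 2, its value at (q, theta); the other part is
    minimal at q ([f2_global_minimizer]).

    Euler-Lagrange equations.  The derivative of the quadratic part with respect
    to theta_j' is <a, e_j>, with respect to q_i' it is - <a, A e_i>, and with
    respect to q_i it is - <a, (D_i A) q'>.  The theta-equations hold because
    <a, e_j> is constant.  To the q_i-equation the quadratic part contributes
    - <a, (d/dt A(q, t)) e_i> + <a, (D_i A) q'>, which vanishes because A has no
    curl: (D_i A) q' = (d/dt A(q, t)) e_i, that is 0 = 0 in case (1) and
    a1'(q) q' = q' a1'(q) in case (2) ([f2_euler_lagrange]). *)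

(** * Limits of matrices *)

Lemma cvg_mxP (R : realType) m n (T : Type) (F : set_system T) (FF : Filter F)
    (f : T -> 'M[R]_(m, n)) (M : 'M[R]_(m, n)) :
  f x @[x --> F] --> M <-> forall i j, f x i j @[x --> F] --> M i j.
Proof.
split=> [fM i j|fM].
  apply: (cvg_comp _ (fun N : 'M[R]_(m, n) => N i j) fM).
  exact: coord_continuous.
move=> U [Q nQ sQ]; rewrite /= nbhs_simpl.
apply: (filterS (P := fun x => forall i j, Q i j (f x i j))).
  by move=> x Qx; apply: sQ.
apply: filter_forall => i; apply: filter_forall => j.
exact: fM (nQ i j).
Qed.

Lemma cvg_mulmx (R : realType) m n p (T : Type) (F : set_system T)
    (FF : Filter F) (f : T -> 'M[R]_(m, n)) (g : T -> 'M[R]_(n, p)) (A : 'M[R]_(m, n))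
    (B : 'M[R]_(n, p)) :
  f x @[x --> F] --> A -> g x @[x --> F] --> B ->
  (f x *m g x) @[x --> F] --> A *m B.
Proof.
move=> /cvg_mxP fA /cvg_mxP gB; apply/cvg_mxP => i j.
have -> : (fun x => (f x *m g x) i j) = (fun x => \sum_k f x i k * g x k j).
  by apply/funext => x; rewrite mxE.
rewrite mxE; apply: cvg_big => [|k _]; first exact: add_continuous.
by apply: cvgM; [exact: fA|exact: gB].
Qed.

(** * Derivatives relative to the unit interval *)

Section DerivativeOnUnitInterval.
Context {R : realType}.
Implicit Types t h : R.

(** The increments h such that h + t stays in [0, 1]; limits along this filter
    are one-sided when t is an endpoint. *)
Definition steps01 t : set_system R := within [set h | 0 <= h + t <= 1] 0^'.

#[global] Instance steps01_proper t : 0 <= t <= 1 -> ProperFilter (steps01 t).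
Proof.
move=> /andP[t0 t1]; apply: Build_ProperFilter_ex => A.
move=> /nbhs_ballP[e /= e0 eA].
(* Step towards the farther endpoint, which is at distance at least 1/2. *)
have [th|th] := leP t 2^-1.
  exists (Num.min (e / 2) 2^-1); apply: eA => /=.
  - rewrite /ball/= sub0r normrN ger0_norm ?le_min; last by apply/andP; split; lra.
    by rewrite gt_min; apply/orP; left; lra.
  - by rewrite gt_eqF// lt_min; apply/andP; split; lra.
  - have : 0 <= Num.min (e / 2) 2^-1 by rewrite le_min; apply/andP; split; lra.
    have : Num.min (e / 2) 2^-1 <= 2^-1 by rewrite ge_min lexx orbT.
    by move=> ? ?; apply/andP; split; lra.
exists (- Num.min (e / 2) 2^-1); apply: eA => /=.
- rewrite /ball/= sub0r opprK ger0_norm ?le_min; last by apply/andP; split; lra.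
  by rewrite gt_min; apply/orP; left; lra.
- by rewrite oppr_eq0 gt_eqF// lt_min; apply/andP; split; lra.
- have : 0 <= Num.min (e / 2) 2^-1 by rewrite le_min; apply/andP; split; lra.
  have : Num.min (e / 2) 2^-1 <= 2^-1 by rewrite ge_min lexx orbT.
  by move=> ? ?; apply/andP; split; lra.
Qed.

(** A relational form of [derive_in I01], which avoids carrying existence proofs
    of limits through the calculus rules. *)
Definition has_dot {V : normedModType R} (f : R -> V) t (d : V) : Prop :=
  h^-1 *: (f (h + t) - f t) @[h --> steps01 t] --> d.

Definition cont01 {V : topologicalType} (f : R -> V) : Prop :=
  forall t, 0 <= t <= 1 -> f s @[s --> within [set s | 0 <= s <= 1] (nbhs t)] --> f t.

Lemma I01E : @I01 R = [set s | 0 <= s <= 1].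
Proof. by apply/seteqP; split=> s; rewrite /I01/= in_itv. Qed.

Lemma cont01P {V : topologicalType} (f : R -> V) :
  {within I01, continuous (f : R^o -> V)} <-> cont01 f.
Proof. by rewrite I01E; exact: subspace_continuousP. Qed.

Lemma eq_cont01 {V : topologicalType} (f g : R -> V) :
  (forall s, 0 <= s <= 1 -> f s = g s) -> cont01 f -> cont01 g.
Proof.
move=> fg fc t t01; rewrite -fg//; move: (fc t t01).
apply: cvg_trans; apply: near_eq_cvg; rewrite near_withinE.
by apply: nearW => s s01; rewrite fg.
Qed.

Lemma quotient_in01E {V : normedModType R} (f : R -> V) t v :
  quotient_in I01 (f : R^o -> V) t v =
  h^-1 *: (f (h * v + t) - f t) @[h --> within [set h | 0 <= h * v + t <= 1] 0^'].
Proof. by rewrite /quotient_in I01E. Qed.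

Section has_dot_theory.
Context {V : normedModType R}.
Implicit Types (f g : R -> V) (d : V).

Lemma near_within_neq0 (D : set R) : \forall h \near within D 0^', h != 0.
Proof.
by rewrite near_withinE; near=> h => _; near: h; exact: nbhs_dnbhs_neq.
Unshelve. all: by end_near. Qed.

Lemma steps01_in t : \forall h \near steps01 t, 0 <= h + t <= 1.
Proof. by near=> h; near: h; exact: withinT. Unshelve. all: by end_near. Qed.

Lemma steps01_cvg0 t : h @[h --> steps01 t] --> (0 : R).
Proof. by apply: cvg_within_filter; exact: nbhs_dnbhs. Qed.

Lemma eq_has_dot f g t d : 0 <= t <= 1 ->
  (forall s, 0 <= s <= 1 -> f s = g s) -> has_dot f t d -> has_dot g t d.
Proof.
move=> t01 fg; apply: cvg_trans; apply: near_eq_cvg; near=> h.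
by rewrite !fg//; near: h; exact: steps01_in.
Unshelve. all: by end_near. Qed.

Lemma has_dot_cvg f t d : has_dot f t d -> f (h + t) @[h --> steps01 t] --> f t.
Proof.
move=> fd.
have : h *: (h^-1 *: (f (h + t) - f t)) + f t @[h --> steps01 t] --> f t.
  rewrite -[X in _ --> X]add0r -[X in _ --> X + _](scale0r d).
  apply: cvgD; last exact: cvg_cst.
  by apply: cvgZ fd; exact: steps01_cvg0.
apply: cvg_trans; apply: near_eq_cvg; near=> h.
rewrite scalerA divff ?scale1r ?subrK//; near: h; exact: near_within_neq0.
Unshelve. all: by end_near. Qed.

(** The filters of [has_dot] and [cont01] differ: the former moves the origin to t
    and removes it. *)
Lemma has_dot_cont01 f df :
  (forall t, 0 <= t <= 1 -> has_dot f t (df t)) -> cont01 f.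
Proof.
move=> fd t t01; have /cvgrPdist_lt fc := has_dot_cvg (fd t t01).
apply/cvgrPdist_lt => e e0; have := fc _ e0.
rewrite /steps01 !near_withinE => /nbhs_ballP[r /= r0 rP].
apply/nbhs_ballP; exists r => //= s sr s01.
have [->|st] := eqVneq s t; first by rewrite subrr normr0.
rewrite -[s](subrK t); apply: rP => //=.
- by rewrite /ball/= sub0r opprB.
- by rewrite subr_eq0.
- by rewrite subrK.
Qed.

(** The direction v only rescales the increment, so the derivative in direction 1
    controls all those that [Ck_in] quantifies over. *)
Lemma has_dot_quotient f t d : has_dot f t d ->
  forall v : R, quotient_in I01 (f : R^o -> V) t v --> v *: d.
Proof.
move=> fd v; rewrite quotient_in01E.
have [->|v0] := eqVneq v 0.
  rewrite scale0r.
  under eq_fun do rewrite mulr0 add0r subrr scaler0.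
  exact: cvg_cst.
have H : h * v @[h --> within [set h | 0 <= h * v + t <= 1] 0^'] --> steps01 t.
  have H0 : h * v @[h --> (0:R)^'] --> (0:R)^'.
    move=> U /nbhs_ballP[e /= e0 eU]; apply/nbhs_ballP.
    exists (e / `|v|) => /=; first by rewrite divr_gt0// normr_gt0.
    move=> h; rewrite /ball/= sub0r normrN ltr_pdivlMr ?normr_gt0// => hv h0.
    apply: eU; last by rewrite mulf_neq0.
    by rewrite /ball/= sub0r normrN normrM.
  move=> U; rewrite /steps01 /within/= => HU.
  exact: H0 _ HU.
have := cvg_comp _ _ H fd => /(cvgZ (cvg_cst v)).
apply: cvg_trans; apply: near_eq_cvg; near=> h.
have h0 : h != 0 by near: h; exact: near_within_neq0.
by rewrite /= scalerA invfM mulrCA divff// mulr1.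
Unshelve. all: by end_near. Qed.

Lemma derive_inE f t d : 0 <= t <= 1 -> has_dot f t d ->
  forall v : R, derive_in I01 (f : R^o -> V) t v = v *: d.
Proof.
move=> t01 /has_dot_quotient fd v.
have := fd v; rewrite /derive_in quotient_in01E.
apply: (@cvg_lim V (@norm_hausdorff _ V)).
have [->|v0] := eqVneq v 0.
  apply: Build_ProperFilter_ex => A.
  rewrite /within/= nearE => /nbhs_ballP[e /= e0 eA].
  exists (e / 2); apply: eA => /=; last by rewrite mulr0 add0r.
    by rewrite /ball/= sub0r normrN ger0_norm; lra.
  by rewrite gt_eqF//; lra.
have FF := steps01_proper t01.
have : h / v @[h --> steps01 t] --> within [set h | 0 <= h * v + t <= 1] 0^'.
  move=> U; rewrite /steps01 /within/= !nbhs_simpl/= => /nbhs_ballP[e /= e0 eU].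
  apply/nbhs_ballP.
  exists (e * `|v|) => /=; first by rewrite mulr_gt0// normr_gt0.
  move=> h; rewrite /ball/= sub0r normrN => hv h0 ht.
  apply: eU; last by rewrite divfK.
    by rewrite /ball/= sub0r normrN normrM normfV ltr_pdivrMr ?normr_gt0.
  by rewrite mulf_neq0 ?invr_eq0.
move=> H; apply: Build_ProperFilter_ex => A /H /filter_ex[h hA].
by exists h.
Qed.

Lemma derivable_inP f t : derivable_in I01 (f : R^o -> V) t 1 ->
  has_dot f t (derive_in I01 (f : R^o -> V) t 1).
Proof.
rewrite /derivable_in /derive_in quotient_in01E.
rewrite /has_dot /steps01.
by under eq_fun do rewrite mulr1; under eq_set do rewrite mulr1.
Qed.

Lemma has_dot_derivable f t d : has_dot f t d ->
  derivable_in I01 (f : R^o -> V) t 1.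
Proof. by move=> /has_dot_quotient fd; apply/cvg_ex; exists (1 *: d); exact: fd. Qed.

Lemma has_dot_cst (c : V) t : has_dot (fun=> c) t 0.
Proof.
rewrite /has_dot; under eq_fun do rewrite subrr scaler0.
exact: cvg_cst.
Qed.

Lemma has_dotD f g t d e : has_dot f t d -> has_dot g t e ->
  has_dot (fun s => f s + g s) t (d + e).
Proof.
move=> fd ge; rewrite /has_dot.
under eq_fun do rewrite opprD addrACA scalerDr.
exact: cvgD.
Qed.

Lemma has_dotN f t d : has_dot f t d -> has_dot (fun s => - f s) t (- d).
Proof.
move=> fd; rewrite /has_dot.
under eq_fun do rewrite -opprD scalerN.
exact: cvgN.
Qed.

Lemma has_dotZ (k : R -> R^o) f t (dk : R^o) d : has_dot k t dk -> has_dot f t d ->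
  has_dot (fun s => k s *: f s) t (dk *: f t + k t *: d).
Proof.
move=> kd fd; rewrite /has_dot.
have -> : (fun h => h^-1 *: (k (h + t) *: f (h + t) - k t *: f t)) =
  fun h => (h^-1 * (k (h + t) - k t)) *: f (h + t) +
           k t *: (h^-1 *: (f (h + t) - f t)).
  apply/funext => h; rewrite scalerA [k t * _]mulrC -!scalerA -scalerDr.
  by congr (_ *: _); rewrite scalerBl scalerBr subrKA.
apply: cvgD; first by apply: cvgZ => //; exact: has_dot_cvg fd.
by apply: cvgZ => //; exact: cvg_cst.
Qed.

End has_dot_theory.

(** Chain rule by Caratheodory's argument: the difference quotient of F, extended
    by d at 0, is continuous there, and no division by the increment of k is
    made. *)
Lemma has_dot_comp {V : normedModType R} (F : R -> V) (k : R -> R^o) t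
    (dk : R^o) (d : V) :
  h^-1 *: (F (h + k t) - F (k t)) @[h --> 0^'] --> d ->
  has_dot k t dk -> has_dot (F \o k) t (dk *: d).
Proof.
move=> Fd kd.
pose slope (h : R) : V := if h == 0 then d else h^-1 *: (F (h + k t) - F (k t)).
have slope0 : slope 0 = d by rewrite /slope eqxx.
have slopec : {for (0 : R), continuous slope}.
  apply/continuous_withinNx; rewrite slope0.
  move: Fd; apply: cvg_trans; apply: near_eq_cvg; near=> h.
  rewrite /slope ifN//; near: h; exact: nbhs_dnbhs_neq.
have k0 : k (h + t) - k t @[h --> steps01 t] --> 0.
  rewrite -[X in _ --> X](subrr (k t)); apply: (cvgB (V := R^o)); last exact: cvg_cst.
  exact: has_dot_cvg kd.
have s0 := cvg_comp _ _ k0 slopec.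
have : (h^-1 * (k (h + t) - k t)) *: slope (k (h + t) - k t)
    @[h --> steps01 t] --> dk *: d.
  by rewrite -slope0; exact: (cvgZ (V := V) kd s0).
apply: cvg_trans; apply: near_eq_cvg; near=> h.
rewrite /slope/=; case: eqVneq => [e0|kh].
  have e1 : k (h + t) = k t by apply/eqP; rewrite -subr_eq0 e0.
  by rewrite e1 !subrr scaler0 mulr0 scale0r.
by rewrite scalerA mulfK// subrK.
Unshelve. all: by end_near. Qed.

Lemma has_dot_id t : has_dot (id : R -> R^o) t 1.
Proof.
have : (1 : R^o) @[h --> steps01 t] --> (1 : R^o) by exact: cvg_cst.
apply: cvg_trans; apply: near_eq_cvg; near=> h.
rewrite /= addrK [RHS]mulVf//; near: h; exact: near_within_neq0.
Unshelve. all: by end_near. Qed.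

Lemma has_dot_mxP m n (f : R -> 'M[R]_(m, n)) t d :
  has_dot f t d <-> forall i j, has_dot (fun s => f s i j : R^o) t (d i j).
Proof.
rewrite /has_dot; split=> [/cvg_mxP fd i j|fd].
  by have := fd i j; under eq_fun do rewrite !mxE.
by apply/cvg_mxP => i j; under eq_fun do rewrite !mxE; exact: fd.
Qed.

Lemma has_dot_mulmx m n p (f : R -> 'M[R]_(m, n)) (g : R -> 'M[R]_(n, p)) t df dg :
  has_dot f t df -> has_dot g t dg ->
  has_dot (fun s => f s *m g s) t (df *m g t + f t *m dg).
Proof.
move=> fd gd; rewrite /has_dot.
have -> : (fun h => h^-1 *: (f (h + t) *m g (h + t) - f t *m g t)) =
  fun h => (h^-1 *: (f (h + t) - f t)) *m g (h + t) +
           f t *m (h^-1 *: (g (h + t) - g t)).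
  apply/funext => h; rewrite -scalemxAl -scalemxAr -scalerDr.
  by rewrite mulmxBl mulmxBr subrKA.
apply: cvgD; first by apply: cvg_mulmx => //; exact: has_dot_cvg gd.
by apply: cvg_mulmx => //; exact: cvg_cst.
Qed.

(** Being a trajectory is used only through this lemma and its converse
    [has_dot_trajectory], which replace the directional derivatives of [Ck_in] by
    velocities and accelerations. *)
Lemma trajectoryP n (y : R -> 'cV[R]_n) : trajectory y ->
  [/\ forall t, 0 <= t <= 1 -> has_dot y t (dot y t),
      exists2 a : R -> 'cV[R]_n,
        forall t, 0 <= t <= 1 -> has_dot (dot y) t (a t) & cont01 a,
      cont01 y & cont01 (dot y)].
Proof.
move=> [/cont01P yc /(_ 1)[yd [/cont01P dc /(_ 1)[dd [/cont01P ddc _]]]]].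
have in01 t : 0 <= t <= 1 -> @I01 R t by rewrite I01E.
split=> //; first by move=> t /in01 t01; apply: derivable_inP; exact: yd.
exists (derive_in I01 (dot y : R^o -> _) ^~ 1) => //.
by move=> t /in01 t01; apply: derivable_inP; exact: dd.
Qed.

Lemma dotE n (y : R -> 'cV[R]_n) t d : 0 <= t <= 1 -> has_dot y t d ->
  dot y t = d.
Proof. by move=> t01 yd; rewrite /dot (derive_inE t01 yd) scale1r. Qed.

Lemma has_dot_trajectory n (y v a : R -> 'cV[R]_n) :
  (forall t, 0 <= t <= 1 -> has_dot y t (v t)) ->
  (forall t, 0 <= t <= 1 -> has_dot v t (a t)) -> cont01 a -> trajectory y.
Proof.
move=> yv va ac; rewrite /trajectory/=.
have Icc t : @I01 R t -> 0 <= t <= 1 by rewrite I01E.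
have Ew (w : R^o) t : 0 <= t <= 1 -> derive_in I01 (y : R^o -> _) t w = w *: v t.
  by move=> t01; exact: derive_inE (yv t t01) w.
have dw (w : R^o) t : 0 <= t <= 1 ->
    has_dot (fun a : R => derive_in I01 (y : R^o -> _) a w) t (w *: a t).
  move=> t01; apply: (@eq_has_dot _ (fun s => w *: v s)) => //.
    by move=> s s01; rewrite Ew.
  have := has_dotZ (has_dot_cst (w : R^o) t) (va t t01).
  by rewrite scale0r add0r.
split; first by apply/cont01P; exact: has_dot_cont01 yv.
move=> w; split.
  move=> t /Icc t01; apply/cvg_ex; exists (w *: v t).
  exact: has_dot_quotient (yv t t01) w.
split; first by apply/cont01P; exact: has_dot_cont01 (dw w).
move=> u; split.
  move=> t /Icc t01; apply/cvg_ex; exists (u *: (w *: a t)).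
  exact: has_dot_quotient (dw w t t01) u.
split=> //; apply/cont01P; apply: (eq_cont01 (f := fun t => u *: (w *: a t))).
  by move=> t t01; rewrite (derive_inE t01 (dw w t t01)).
by move=> t t01; apply: cvgZ; [exact: cvg_cst|apply: cvgZ; [exact: cvg_cst|exact: ac]].
Qed.

End DerivativeOnUnitInterval.

(** * Integration on the unit interval *)

Section UnitIntervalIntegral.
Context {R : realType}.
Notation mu := (@lebesgue_measure R).

Lemma cont01_comp {U V : topologicalType} (S : set U) (f : U -> V) (g : R -> U) :
  {within S, continuous f} -> (forall t, 0 <= t <= 1 -> S (g t)) ->
  cont01 g -> cont01 (f \o g).
Proof.
move=> /subspace_continuousP fc gS gc t t01.
apply: cvg_comp (fc _ (gS _ t01)) => Q; rewrite /within/= => SQ.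
have := gc t t01 _ SQ; rewrite /= !nbhs_simpl /within/=.
by apply: filterS => s + s01; apply => //; exact: gS.
Qed.

Lemma has_dot_interior {V : normedModType R} (f : R -> V) t d : 0 < t < 1 ->
  has_dot f t d -> h^-1 *: (f (h + t) - f t) @[h --> 0^'] --> d.
Proof.
move=> /andP[t0 t1]; apply: cvg_trans => U SU.
have H : \forall h \near 0^', 0 <= h + t <= 1.
  near=> h; have : `|h| < Num.min t (1 - t).
    near: h; apply: dnbhs0_lt; rewrite lt_min; apply/andP; split; lra.
  rewrite lt_min !ltr_norml => /andP[/andP[? ?] /andP[? ?]].
  by apply/andP; split; lra.
have {}SU : \forall h \near 0^', 0 <= h + t <= 1 -> U (h^-1 *: (f (h + t) - f t)).
  exact: SU.
by apply: filterS (filterI SU H) => h [] /[apply].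
Unshelve. all: by end_near. Qed.

Lemma cont01_at_right (f : R -> R^o) t : 0 <= t < 1 -> cont01 f ->
  f s @[s --> t^'+] --> f t.
Proof.
move=> /andP[t0 t1] fc; have t01 : 0 <= t <= 1 by rewrite t0 ltW.
move: (fc t t01); apply: cvg_trans => U SU.
have H : \forall s \near t, s < 1 by exact: lt_nbhsl.
have {}SU : \forall s \near t, 0 <= s <= 1 -> U (f s) by exact: SU.
apply: filterS (filterI SU H) => s [+ s1] ts; apply.
by rewrite (le_trans t0 (ltW ts)) ltW.
Qed.

Lemma cont01_at_left (f : R -> R^o) t : 0 < t <= 1 -> cont01 f ->
  f s @[s --> t^'-] --> f t.
Proof.
move=> /andP[t0 t1] fc; have t01 : 0 <= t <= 1 by rewrite ltW.
move: (fc t t01); apply: cvg_trans => U SU.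
have H : \forall s \near t, 0 < s by exact: lt_nbhsr.
have {}SU : \forall s \near t, 0 <= s <= 1 -> U (f s) by exact: SU.
apply: filterS (filterI SU H) => s [+ s0] ts; apply.
by rewrite (le_trans (ltW ts) t1) ltW.
Qed.

Lemma cont01_within (f : R -> R^o) t : t <= 1 -> cont01 f ->
  {within `[0, t], continuous f}.
Proof.
move=> t1 /cont01P; apply: continuous_subspaceW => s/=; rewrite I01E/= in_itv/=.
by move=> /andP[-> /le_trans]; apply.
Qed.

Lemma cont01_integrable (f : R -> R^o) : cont01 f ->
  mu.-integrable `[0, 1] (EFin \o f).
Proof.
move=> fc; apply: continuous_compact_integrable; first exact: segment_compact.
exact: cont01_within.
Qed.

(** Fundamental theorem of calculus. *)
Lemma Rintegral_has_dot (g g' : R -> R^o) t : 0 <= t <= 1 ->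
  (forall s, 0 <= s <= 1 -> has_dot g s (g' s)) -> cont01 g' ->
  \int[mu]_(s in `[0, t]) g' s = g t - g 0.
Proof.
move=> /andP[]; rewrite le_eqVlt => /predU1P[<- _ _ _|t0 t1 gd g'c].
  by rewrite set_itv1 Rintegral_set1 subrr.
have gc := has_dot_cont01 gd.
have gd' s : s \in `]0, t[ -> h^-1 *: (g (h + s) - g s) @[h --> 0^'] --> g' s.
  rewrite in_itv/= => /andP[s0 st]; apply: has_dot_interior.
    by rewrite s0 (lt_le_trans st).
  by apply: gd; rewrite (ltW s0) (le_trans (ltW st)).
rewrite /Rintegral (@continuous_FTC2 _ g' g 0 t)//.
- exact: cont01_within.
- split.
  + move=> s /gd' gs; apply/cvg_ex; exists (g' s).
    by under eq_fun do rewrite [_ *: 1]mulr1.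
  + by apply: cont01_at_right => //; rewrite lexx/=.
  + by apply: cont01_at_left => //; rewrite t0.
- by move=> s /gd' gs; rewrite /derive1; apply: cvg_lim gs.
Qed.

(** The integral over [a, x] vanishes when x < a, so the antiderivative at x is
    computed from a base point to the left of both x and 0.  Normalizing at 0
    makes the value independent of that base point ([FE]). *)
Lemma continuous_antiderivative (f : R -> R^o) : continuous f ->
  exists F : R -> R^o, forall x, h^-1 *: (F (h + x) - F x) @[h --> 0^'] --> f x.
Proof.
move=> fc.
have fint a b : mu.-integrable `[a, b] (EFin \o f).
  apply: continuous_compact_integrable; first exact: segment_compact.
  exact: continuous_subspaceT.
pose P (a x : R) : R^o := \int[mu]_(s in `[a, x]) f s.
have oc a x : \int[mu]_(s in `]a, x]) f s = P a x.
  apply: Rintegral_itv_obnd_cbnd; apply: integrableS (fint a x) => //.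
  exact: subset_itv_oc_cc.
have PB a b x : a <= b -> b <= x -> P a x = P a b + P b x.
  move=> ab bx; apply/eqP; rewrite addrC -subr_eq; apply/eqP.
  by rewrite -[RHS]oc; apply: Rintegral_itvB.
pose F (x : R) : R^o := P (Num.min x 0 - 1) x - P (Num.min x 0 - 1) 0.
have FE a x : a <= Num.min x 0 - 1 -> F x = P a x - P a 0.
  move=> ax; have [mx m0] : Num.min x 0 <= x /\ Num.min x 0 <= 0.
    by rewrite !ge_min !lexx orbT.
  have E1 := PB _ _ x ax ltac:(lra); have E2 := PB _ _ 0 ax ltac:(lra).
  by rewrite /F E1 E2 [in RHS]opprD addrACA subrr add0r.
exists F => x.
(* The margin 2 makes a an admissible base point for all h + x with |h| < 1. *)
pose a := Num.min x 0 - 2.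
have ax : a < x.
  have mx : Num.min x 0 <= x by rewrite ge_min lexx.
  by rewrite /a; lra.
have [Pd Px] :=
  @continuous_FTC1_closed _ f a x (x + 1) ltac:(lra) (fint _ _) ax (fc x).
have : h^-1 *: (P a (h + x) - P a x) @[h --> 0^'] --> f x.
  rewrite -Px /derive1; move: Pd; rewrite /derivable.
  by under eq_fun do rewrite [_ *: 1]mulr1.
apply: cvg_trans; apply: near_eq_cvg; near=> h.
have h1 : `|h| < 1 by near: h; exact: dnbhs0_lt.
congr (_ *: _); rewrite !(FE a); last 2 first.
- by rewrite /a; lra.
- move: h1; rewrite ltr_norml => /andP[h1 h2].
  have : Num.min x 0 <= x by rewrite ge_min lexx.
  have : Num.min x 0 <= 0 by rewrite ge_min lexx orbT.
  rewrite /a lerBrDr le_min => ? ?; apply/andP; split; lra.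
by rewrite opprB subrKA.
Unshelve. all: by end_near. Qed.

End UnitIntervalIntegral.

(** * The weighted norm *)

Section WeightedNorm.
Context {R : realType} {P : nat}.
Variable W : 'M[R]_P.
Implicit Types x y : 'cV[R]_P.

Definition innerW x y : R := (x^T *m W *m y) ord0 ord0.

Lemma normsqW_inner x : normsqW W x = innerW x x.
Proof. by rewrite /normsqW /innerW trace_mx11. Qed.

Lemma innerWDr x y z : innerW x (y + z) = innerW x y + innerW x z.
Proof. by rewrite /innerW mulmxDr mxE. Qed.

Lemma innerWDl x y z : innerW (x + y) z = innerW x z + innerW y z.
Proof. by rewrite /innerW linearD/= !mulmxDl mxE. Qed.

Lemma innerWZr x k y : innerW x (k *: y) = k * innerW x y.
Proof. by rewrite /innerW -scalemxAr mxE. Qed.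

Lemma innerWZl x k y : innerW (k *: x) y = k * innerW x y.
Proof. by rewrite /innerW linearZ/= -!scalemxAl mxE. Qed.

Lemma innerWNr x y : innerW x (- y) = - innerW x y.
Proof. by rewrite /innerW mulmxN mxE. Qed.

Lemma innerW0r x : innerW x 0 = 0.
Proof. by rewrite /innerW mulmx0 mxE. Qed.

Lemma cvg_innerW (T : Type) (F : set_system T) (FF : Filter F)
    (f g : T -> 'cV[R]_P) x y :
  f s @[s --> F] --> x -> g s @[s --> F] --> y ->
  innerW (f s) (g s) @[s --> F] --> innerW x y.
Proof.
move=> fx gy; apply: (iffLR (cvg_mxP _ _ _)).
apply: cvg_mulmx => //; apply: cvg_mulmx; last exact: cvg_cst.
apply/cvg_mxP => i j; under eq_fun do rewrite mxE.
by rewrite mxE; move/cvg_mxP : fx; exact.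
Qed.

Hypothesis W_sym : W^T = W.

Lemma innerWC x y : innerW x y = innerW y x.
Proof.
rewrite /innerW -[in LHS](trmxK (_ *m y)) mxE.
by rewrite !trmx_mul trmxK W_sym mulmxA.
Qed.

Lemma normsqWD x y :
  normsqW W (x + y) = normsqW W x + 2 * innerW x y + normsqW W y.
Proof.
by rewrite !normsqW_inner innerWDr !innerWDl [innerW y x]innerWC; ring.
Qed.

(** With d' = delta h / h, the quotient equals 2 <B, d'> + h |d'|^2. *)
Lemma cvg_normsqW_quotient (B d : 'cV[R]_P) (delta : R -> 'cV[R]_P) :
  h^-1 *: delta h @[h --> 0^'] --> d ->
  h^-1 * (normsqW W (B + delta h) - normsqW W B) @[h --> 0^'] -->
  2 * innerW B d.
Proof.
move=> dd.
have : 2 * innerW B (h^-1 *: delta h) +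
    h * innerW (h^-1 *: delta h) (h^-1 *: delta h) @[h --> 0^'] --> 2 * innerW B d.
  rewrite -[X in _ --> X]addr0 -[X in _ --> _ + X](mul0r (innerW d d)).
  apply: (cvgD (V := R^o)).
    apply: (cvgM (cvg_cst _)); apply: cvg_innerW => //; exact: cvg_cst.
  by apply: cvgM; [exact: nbhs_dnbhs|exact: cvg_innerW].
apply: cvg_trans; apply: near_eq_cvg; near=> h.
have h0 : h != 0 by near: h; exact: nbhs_dnbhs_neq.
rewrite normsqWD [normsqW W (delta h)]normsqW_inner !innerWZr innerWZl.
by field.
Unshelve. all: by end_near. Qed.

Lemma is_derive_add_normsqW (V : normedModType R) (g : V -> R^o)
    (C : V -> 'cV[R]_P) (x e : V) d :
  derivable g x e -> h^-1 *: (C (h *: e + x) - C x) @[h --> 0^'] --> d ->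
  is_derive x e (fun u : V => g u + 2^-1 * normsqW W (C u) : R^o)
    ('D_e g x + innerW (C x) d).
Proof.
move=> gd Cd.
have H : h^-1 *: ((g (h *: e + x) + 2^-1 * normsqW W (C (h *: e + x)) : R^o) -
    (g x + 2^-1 * normsqW W (C x))) @[h --> 0^'] --> ('D_e g x + innerW (C x) d : R^o).
  have K := cvg_normsqW_quotient (B := C x) Cd.
  have : h^-1 *: (g (h *: e + x) - g x) +
     2^-1 * (h^-1 * (normsqW W (C x + (C (h *: e + x) - C x)) - normsqW W (C x)))
     @[h --> 0^'] --> ('D_e g x + 2^-1 * (2 * innerW (C x) d) : R^o).
    by apply: (cvgD (V := R^o)) => //; apply: cvgM => //; exact: cvg_cst.
  rewrite mulrA mulVf ?mul1r ?pnatr_eq0//.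
  apply: cvg_trans; apply: near_eq_cvg; near=> h.
  by rewrite [C x + _]addrC subrK /GRing.scale/=; ring.
split; first by apply/cvg_ex; eexists; exact: H.
exact: (@cvg_lim R^o (@norm_hausdorff _ _) _ _ _ _ _ H).
Unshelve. all: by end_near. Qed.

(** A convex function lies above its tangents. *)
Lemma normsqW_tangent x y : (forall z, z != 0 -> 0 < innerW z z) ->
  normsqW W x + 2 * innerW x (y - x) <= normsqW W y.
Proof.
move=> Wpos; rewrite -{2}[y](subrKC x) normsqWD lerDl normsqW_inner.
have [->|z0] := eqVneq (y - x) 0; first by rewrite innerW0r.
by apply/ltW; exact: Wpos.
Qed.

End WeightedNorm.

(** * Directional derivatives of the completed Lagrangian *)

Section SquareCompletion.
Context {R : realType} {N P : nat}.
Variables (f1 : 'cV[R]_N -> 'cV[R]_N -> R -> R).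
Variables (A : 'cV[R]_N -> R -> 'M[R]_(P, N)) (W : 'M[R]_P).

Definition residual (x v : 'cV[R]_(N + P)) t : 'cV[R]_P :=
  dsubmx v - A (usubmx x) t *m usubmx v.

Lemma is_derive_usubmx (g : 'cV[R]_N -> R^o) (x e : 'cV[R]_(N + P)) :
  derivable g (usubmx x) (usubmx e) ->
  derivable (g \o usubmx) x e /\
  'D_e (g \o usubmx) x = 'D_(usubmx e) g (usubmx x).
Proof.
rewrite /derivable /derive.
under eq_fun do rewrite /=.
have -> : (fun h : R => h^-1 *: ((g \o usubmx) (h *: e + x) - (g \o usubmx) x)) =
  fun h => h^-1 *: (g (h *: usubmx e + usubmx x) - g (usubmx x)).
  by apply/funext => h /=; rewrite [usubmx (_ + _)]linearP.
by [].
Qed.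

Hypothesis W_sym : W^T = W.

(** The blocks of x, v, e and the residual are parameters, so that they can be
    supplied in the simplified form that they take along a path. *)
Lemma f2_is_derive_pos (x v e : 'cV[R]_(N + P)) t (D : 'M[R]_(P, N)) q dq eq r :
  usubmx x = q -> usubmx v = dq -> usubmx e = eq -> residual x v t = r ->
  derivable (fun u => f1 u dq t : R^o) q eq ->
  h^-1 *: (A (h *: eq + q) t - A q t) @[h --> 0^'] --> D ->
  is_derive x e (fun u => f2 f1 A W u v t : R^o)
    ('D_eq (fun u => f1 u dq t : R^o) q - innerW W r (D *m dq)).
Proof.
move=> <- <- <- <- /is_derive_usubmx[gd <-] AD; rewrite -innerWNr.
apply: (is_derive_add_normsqW W_sym (C := fun u => residual u v t)) => //.
have : - ((h^-1 *: (A (h *: usubmx e + usubmx x) t - A (usubmx x) t)) *m usubmx v)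
    @[h --> 0^'] --> - (D *m usubmx v).
  by apply: cvgN; apply: cvg_mulmx => //; exact: cvg_cst.
apply: cvg_trans; apply: near_eq_cvg; near=> h.
rewrite /residual [usubmx (_ + _)]linearP/= [in RHS]opprD addrACA subrr add0r.
by rewrite -opprD scalerN -mulmxBl scalemxAl.
Unshelve. all: by end_near. Qed.

Lemma f2_is_derive_vel (x v e : 'cV[R]_(N + P)) t q dq eq r re :
  usubmx x = q -> usubmx v = dq -> usubmx e = eq -> residual x v t = r ->
  residual x e t = re ->
  derivable (fun u => f1 q u t : R^o) dq eq ->
  is_derive v e (fun u => f2 f1 A W x u t : R^o)
    ('D_eq (fun u => f1 q u t : R^o) dq + innerW W r re).
Proof.
move=> <- <- <- <- <- /is_derive_usubmx[gd <-].
apply: (is_derive_add_normsqW W_sym (C := fun u => residual x u t)) => //.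
have : residual x e t @[h --> (0:R)^'] --> residual x e t by exact: cvg_cst.
apply: cvg_trans; apply: near_eq_cvg; near=> h.
have h0 : h != 0 by near: h; exact: nbhs_dnbhs_neq.
have -> : residual x (h *: e + v) t = h *: residual x e t + residual x v t.
  rewrite /residual [usubmx (_ + _)]linearP [dsubmx (_ + _)]linearP/= mulmxDr.
  rewrite opprD addrACA.
  by rewrite -scalemxAr scalerBr.
by rewrite addrK scalerA mulVf ?scale1r.
Unshelve. all: by end_near. Qed.

Lemma usubmx_ei_lshift (i : 'I_N) : usubmx (ei (lshift P i)) = ei i :> 'cV[R]_N.
Proof. by apply/matrixP => k l; rewrite !mxE (inj_eq (@lshift_inj _ _)). Qed.

Lemma dsubmx_ei_lshift (i : 'I_N) : dsubmx (ei (lshift P i)) = 0 :> 'cV[R]_P.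
Proof. by apply/matrixP => k l; rewrite !mxE eq_rlshift. Qed.

Lemma usubmx_ei_rshift (i : 'I_P) : usubmx (ei (rshift N i)) = 0 :> 'cV[R]_N.
Proof. by apply/matrixP => k l; rewrite !mxE eq_lrshift. Qed.

Lemma dsubmx_ei_rshift (i : 'I_P) : dsubmx (ei (rshift N i)) = ei i :> 'cV[R]_P.
Proof. by apply/matrixP => k l; rewrite !mxE (inj_eq (@rshift_inj _ _)). Qed.

End SquareCompletion.

(** * Calculus of matrix-valued paths *)

Section MatrixPaths.
Context {R : realType}.

Lemma cont01_mxP m n (f : R -> 'M[R]_(m, n)) :
  cont01 f <-> forall i j, cont01 (fun s => f s i j : R^o).
Proof.
split=> [fc i j t /fc /cvg_mxP|fc t t01]; first exact.
by apply/cvg_mxP => i j; exact: fc.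
Qed.

Lemma cont01D {V : normedModType R} (f g : R -> V) :
  cont01 f -> cont01 g -> cont01 (fun s => f s + g s).
Proof. by move=> fc gc t t01; apply: cvgD; [exact: fc|exact: gc]. Qed.

Lemma cont01_cst {V : topologicalType} (c : V) : cont01 (fun _ : R => c).
Proof. by move=> t _; exact: cvg_cst. Qed.

Lemma cont01_mulmx m n p (f : R -> 'M[R]_(m, n)) (g : R -> 'M[R]_(n, p)) :
  cont01 f -> cont01 g -> cont01 (fun s => f s *m g s).
Proof. by move=> fc gc t t01; apply: cvg_mulmx; [exact: fc|exact: gc]. Qed.

Lemma cont01_pair {U V : topologicalType} (f : R -> U) (g : R -> V) :
  cont01 f -> cont01 g -> cont01 (fun s => (f s, g s)).
Proof. by move=> fc gc t t01; apply: cvg_pair; [exact: fc|exact: gc]. Qed.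

Lemma cont01_id : cont01 (id : R -> R^o).
Proof. by move=> t _; exact: cvg_within. Qed.

Lemma cont01_col_mx m n (f : R -> 'cV[R]_m) (g : R -> 'cV[R]_n) :
  cont01 f -> cont01 g -> cont01 (fun s => col_mx (f s) (g s)).
Proof.
move=> /cont01_mxP fc /cont01_mxP gc; apply/cont01_mxP => i j.
case: (split_ordP i) => k ->.
  by under eq_fun do rewrite col_mxEu; exact: fc.
by under eq_fun do rewrite col_mxEd; exact: gc.
Qed.

Lemma has_dot_col_mx m n (f : R -> 'cV[R]_m) (g : R -> 'cV[R]_n) t df dg :
  has_dot f t df -> has_dot g t dg ->
  has_dot (fun s => col_mx (f s) (g s)) t (col_mx df dg).
Proof.
move=> /has_dot_mxP fd /has_dot_mxP gd; apply/has_dot_mxP => i j.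
case: (split_ordP i) => k ->.
  by rewrite col_mxEu; under eq_fun do rewrite col_mxEu; exact: fd.
by rewrite col_mxEd; under eq_fun do rewrite col_mxEd; exact: gd.
Qed.

Lemma has_dot_usubmx m n (f : R -> 'cV[R]_(m + n)) t d :
  has_dot f t d -> has_dot (fun s => usubmx (f s)) t (usubmx d).
Proof.
move=> /has_dot_mxP fd; apply/has_dot_mxP => i j; rewrite mxE.
by under eq_fun do rewrite mxE; exact: fd.
Qed.

Lemma has_dot_dsubmx m n (f : R -> 'cV[R]_(m + n)) t d :
  has_dot f t d -> has_dot (fun s => dsubmx (f s)) t (dsubmx d).
Proof.
move=> /has_dot_mxP fd; apply/has_dot_mxP => i j; rewrite mxE.
by under eq_fun do rewrite mxE; exact: fd.
Qed.

Lemma cont01_usubmx m n (f : R -> 'cV[R]_(m + n)) :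
  cont01 f -> cont01 (fun s => usubmx (f s)).
Proof.
move=> /cont01_mxP fc; apply/cont01_mxP => i j.
by under eq_fun do rewrite mxE; exact: fc.
Qed.

Lemma cont01_dsubmx m n (f : R -> 'cV[R]_(m + n)) :
  cont01 f -> cont01 (fun s => dsubmx (f s)).
Proof.
move=> /cont01_mxP fc; apply/cont01_mxP => i j.
by under eq_fun do rewrite mxE; exact: fc.
Qed.

Lemma trajectory_usubmx m n (z : R -> 'cV[R]_(m + n)) : trajectory z ->
  trajectory (fun s => usubmx (z s)) /\
  (forall t, 0 <= t <= 1 -> dot (fun s => usubmx (z s)) t = usubmx (dot z t)).
Proof.
move=> /trajectoryP[zd [a ad ac] _ _]; split.
  apply: (@has_dot_trajectory _ _ _ (fun s => usubmx (dot z s))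
    (fun s => usubmx (a s))).
  - by move=> t t01; exact/has_dot_usubmx/zd.
  - by move=> t t01; exact/has_dot_usubmx/ad.
  - exact: cont01_usubmx.
by move=> t t01; apply: dotE => //; exact/has_dot_usubmx/zd.
Qed.

Lemma has_dot_innerW n (W : 'M[R]_n) (a : 'cV[R]_n) (f : R -> 'cV[R]_n) t d :
  has_dot f t d -> has_dot (fun s => innerW W a (f s) : R^o) t (innerW W a d).
Proof.
move=> fd; have := has_dot_mulmx (has_dot_cst (a^T *m W) t) fd.
by rewrite mul0mx add0r => /has_dot_mxP; exact.
Qed.

Lemma cont01_innerW n (W : 'M[R]_n) (f g : R -> 'cV[R]_n) :
  cont01 f -> cont01 g -> cont01 (fun s => innerW W (f s) (g s) : R^o).
Proof. by move=> fc gc t t01; apply: cvg_innerW; [exact: fc|exact: gc]. Qed.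

End MatrixPaths.

(** * Fields with a potential *)

(** The common abstraction of the two cases.  [A_curl] says that A is curl-free
    along q; [DA] is the derivative of A along q. *)
Record potential_along {R : realType} {N P : nat}
    (A : 'cV[R]_N -> R -> 'M[R]_(P, N)) (q : R -> 'cV[R]_N)
    (theta : 'cV[R]_P -> 'cV[R]_P -> R -> 'cV[R]_P)
    (G : 'cV[R]_N -> 'cV[R]_P) (DA : R -> 'M[R]_(P, N)) : Prop := {
  G_potential : forall z, trajectory z -> forall t, 0 <= t <= 1 ->
    has_dot (G \o z) t (A (z t) t *m dot z t);
  thetaE : forall a b t, 0 <= t <= 1 ->
    theta a b t = t *: a + b + (G (q t) - G (q 0));
  A_dot : forall t, 0 <= t <= 1 -> has_dot (fun s => A (q s) s) t (DA t);
  DA_cont : cont01 DA;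
  A_curl : forall (i : 'I_N) t, 0 <= t <= 1 ->
    exists2 D : 'M[R]_(P, N),
      h^-1 *: (A (h *: ei i + q t) t - A (q t) t) @[h --> 0^'] --> D &
      D *m dot q t = DA t *m ei i }.

Section Potential.
Context {R : realType} {N P : nat}.
Variables (f1 : 'cV[R]_N -> 'cV[R]_N -> R -> R).
Variables (A : 'cV[R]_N -> R -> 'M[R]_(P, N)) (W : 'M[R]_P).
Variables (q : R -> 'cV[R]_N) (theta : 'cV[R]_P -> 'cV[R]_P -> R -> 'cV[R]_P).
Variables (G : 'cV[R]_N -> 'cV[R]_P) (DA : R -> 'M[R]_(P, N)).

Hypothesis W_posdef : sym_posdef W.
Hypothesis q_trajectory : trajectory q.
Hypothesis GP : potential_along A q theta G DA.

Let y a b t := col_mx (q t) (theta a b t).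

Lemma theta_endpoints (theta0 theta1 : 'cV[R]_P) : exists a b : 'cV[R]_P,
  theta a b 0 = theta0 /\ theta a b 1 = theta1.
Proof.
exists (theta1 - theta0 - (G (q 1) - G (q 0))), theta0.
rewrite !(thetaE GP) ?lexx ?ler01// scale0r subrr addr0 add0r scale1r; split=> //.
by rewrite addrAC subrK subrK.
Qed.

Lemma theta_has_dot a b t : 0 <= t <= 1 ->
  has_dot (theta a b) t (a + A (q t) t *m dot q t).
Proof.
move=> t01; apply: (eq_has_dot (f := fun s => s *: a + b + (G (q s) - G (q 0)))) => //.
  by move=> s s01; rewrite (thetaE GP).
apply: has_dotD.
  have := has_dotD (has_dotZ (has_dot_id t) (has_dot_cst a t)) (has_dot_cst b t).
  by rewrite scale1r scaler0 !addr0.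
rewrite -[A _ _ *m _]addr0; apply: has_dotD; last exact: has_dot_cst.
exact: (G_potential GP).
Qed.

Lemma y_has_dot a b t : 0 <= t <= 1 ->
  has_dot (y a b) t (col_mx (dot q t) (a + A (q t) t *m dot q t)).
Proof.
move=> t01; apply: has_dot_col_mx; last exact: theta_has_dot.
by have [qd _ _ _] := trajectoryP q_trajectory; exact: qd.
Qed.

Lemma dot_yE a b t : 0 <= t <= 1 ->
  dot (y a b) t = col_mx (dot q t) (a + A (q t) t *m dot q t).
Proof. by move=> t01; apply: dotE => //; exact: y_has_dot. Qed.

(** The key identity: the residual of the candidate does not depend on time. *)
Lemma residual_y a b t : 0 <= t <= 1 -> residual A (y a b t) (dot (y a b) t) t = a.
Proof. by move=> t01; rewrite dot_yE// /residual !col_mxKu col_mxKd addrK. Qed.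

Lemma y_trajectory a b : trajectory (y a b).
Proof.
have [qd [c qdd cc] qc qdc] := trajectoryP q_trajectory.
have Ac := has_dot_cont01 (A_dot GP).
apply: (@has_dot_trajectory _ _ _
  (fun t => col_mx (dot q t) (a + A (q t) t *m dot q t))
  (fun t => col_mx (c t) (0 + (DA t *m dot q t + A (q t) t *m c t)))).
- exact: y_has_dot.
- move=> t t01; apply: has_dot_col_mx; first exact: qdd.
  apply: has_dotD; first exact: has_dot_cst.
  by apply: (has_dot_mulmx (f := fun s => A (q s) s)); [exact: (A_dot GP)|exact: qdd].
- apply: cont01_col_mx => //; apply: cont01D; first exact: cont01_cst.
  by apply: cont01D; apply: cont01_mulmx => //; exact: DA_cont GP.
Qed.

(** For a q-index the contributions of the quadratic part to the two sides cancel
    by [A_curl]; for a theta-index the momentum is <a, e_j>, a constant. *)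
Lemma f2_euler_lagrange a b : euler_lagrange f1 q ->
  euler_lagrange (f2 f1 A W) (y a b).
Proof.
move=> EL i t t01 p; have [W_sym _] := W_posdef.
have uy s : usubmx (y a b s) = q s by rewrite col_mxKu.
have udy s : 0 <= s <= 1 -> usubmx (dot (y a b) s) = dot q s.
  by move=> s01; rewrite dot_yE// col_mxKu.
case: (split_ordP i) => j ij.
- have ue : usubmx (ei i) = ei j :> 'cV[R]_N by rewrite ij usubmx_ei_lshift.
  have re s : residual A (y a b s) (ei i) s = - (A (q s) s *m ei j).
    by rewrite /residual uy ue ij dsubmx_ei_lshift sub0r.
  have vel s : 0 <= s <= 1 ->
      is_derive (dot (y a b) s) (ei i) (fun u => f2 f1 A W (y a b s) u s : R^o)
        (partial_vel f1 j (q s) (dot q s) s - innerW W a (A (q s) s *m ei j)).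
    move=> s01; have [_ fd _ _] := EL j s s01.
    rewrite -innerWNr.
    exact: (f2_is_derive_vel W_sym (uy s) (udy s s01) ue (residual_y a b s01) (re s)).
  have [D AD DE] := (A_curl GP) j t t01.
  have [fd gd pd pE] := EL j t t01.
  have := f2_is_derive_pos W_sym (uy t) (udy t t01) ue (residual_y a b t01) fd AD.
  rewrite DE => -[pos_d pos_E].
  have [vel_d _] := vel t t01.
  have p_dot : has_dot p t
      (derive_in I01 (fun s : R^o => partial_vel f1 j (q s) (dot q s) s : R^o) t 1
       - innerW W a (DA t *m ei j)).
    apply: (eq_has_dot (f := fun s => partial_vel f1 j (q s) (dot q s) s
        - innerW W a (A (q s) s *m ei j) : R^o)) => //.
      by move=> s s01; rewrite /p /partial_vel; have [_ ->] := vel s s01.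
    apply: (has_dotD (derivable_inP pd)).
    apply: has_dotN; apply: has_dot_innerW.
    have := has_dot_mulmx ((A_dot GP) _ t01) (has_dot_cst (ei j) t).
    by rewrite mulmx0 addr0.
  split; [exact: pos_d|exact: vel_d|exact: has_dot_derivable p_dot|].
  rewrite (derive_inE t01 p_dot) scale1r /partial_pos pos_E.
  by rewrite opprD opprK addrACA [- innerW _ _ _ + _]addrC subrr addr0.
- have ue : usubmx (ei i) = 0 :> 'cV[R]_N by rewrite ij usubmx_ei_rshift.
  have re s : residual A (y a b s) (ei i) s = ei j.
    by rewrite /residual ue ij dsubmx_ei_rshift mulmx0 subr0.
  have vel s : 0 <= s <= 1 ->
      is_derive (dot (y a b) s) (ei i) (fun u => f2 f1 A W (y a b s) u s : R^o)
        (innerW W a (ei j)).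
    move=> s01; rewrite -[innerW _ _ _]add0r.
    rewrite -(derive0 (fun u => f1 (q s) u s : R^o) (dot q s)).
    apply: (f2_is_derive_vel W_sym (uy s) (udy s s01) ue (residual_y a b s01) (re s)).
    exact: derivable0.
  have A0 : h^-1 *: (A (h *: 0 + q t) t - A (q t) t) @[h --> (0 : R)^'] -->
      (0 : 'M[R]_(P, N)).
    by under eq_fun do rewrite scaler0 add0r subrr scaler0; exact: cvg_cst.
  have := f2_is_derive_pos W_sym (uy t) (udy t t01) ue (residual_y a b t01)
    (derivable0 (f := fun u => f1 u (dot q t) t : R^o) (x := q t)) A0.
  rewrite mul0mx innerW0r derive0 subr0 => -[pos_d pos_E].
  have [vel_d _] := vel t t01.
  have p_dot : has_dot p t 0.
    apply: (eq_has_dot (f := fun=> innerW W a (ei j) : R^o)) => //.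
      by move=> s s01; rewrite /p /partial_vel; have [_ ->] := vel s s01.
    exact: has_dot_cst.
  split; [exact: pos_d|exact: vel_d|exact: has_dot_derivable p_dot|].
  by rewrite (derive_inE t01 p_dot) scaler0 /partial_pos pos_E subrr.
Qed.

Hypothesis f1_C2 : C2_lagrangian f1.
Hypothesis A_C2 : C2_matrix_field A.

Lemma f1_cont z : trajectory z -> cont01 (fun t => f1 (z t) (dot z t) t : R^o).
Proof.
move=> /trajectoryP[_ _ zc zdc]; have [f1c _] := f1_C2.
apply: (cont01_comp (g := fun t => (z t, dot z t, t : R^o)) f1c) => //.
by apply: cont01_pair; [exact: cont01_pair|exact: cont01_id].
Qed.

Lemma A_cont z : trajectory z -> cont01 (fun t => A (z t) t).
Proof.
move=> /trajectoryP[_ _ zc zdc]; have [Ac _] := A_C2.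
apply: (cont01_comp (g := fun t => (z t, t : R^o)) Ac) => //.
by apply: cont01_pair => //; exact: cont01_id.
Qed.

(** The cross term <a, u - a> is the derivative of <a, theta - G(q) - t a>, whose
    values at 0 and 1 are fixed by the boundary conditions and agree. *)
Lemma f2_global_minimizer a b : global_minimizer f1 q ->
  global_minimizer (f2 f1 A W) (y a b).
Proof.
move=> [_ qmin]; split; first exact: y_trajectory.
move=> z zT z0 z1; have [W_sym Wpos] := W_posdef.
have [zd [? _ _] zc zdc] := trajectoryP zT.
pose x t := usubmx (z t).
have [xT dotx] := trajectory_usubmx zT.
pose u t := residual A (z t) (dot z t) t.
pose c := 2^-1 * normsqW W a.
have x0 : x 0 = q 0 by rewrite /x z0 col_mxKu.
have x1 : x 1 = q 1 by rewrite /x z1 col_mxKu.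
have uc : cont01 u.
  apply: cont01D; first exact: cont01_dsubmx.
  move=> t t01; apply: cvgN; move: t t01.
  by apply: cont01_mulmx; [exact: A_cont|exact: cont01_usubmx].
have fxc := f1_cont xT.
have cross_cont : cont01 (fun t => innerW W a (u t - a) : R^o).
  apply: cont01_innerW; first exact: cont01_cst.
  by apply: cont01D => //; exact: cont01_cst.
have cross0 : \int[lebesgue_measure]_(t in `[0, 1]) innerW W a (u t - a) = 0.
  pose g t := innerW W a (dsubmx (z t) - G (x t) - t *: a).
  have -> := @Rintegral_has_dot R g (fun t => innerW W a (u t - a)) 1.
  - rewrite /g z1 z0 !col_mxKd x1 x0 !(thetaE GP) ?lexx ?ler01//.
    rewrite -[_ - _ in LHS]/(_ + - _) -innerWNr -innerWDr.
    rewrite (_ : _ + _ = 0) ?innerW0r//.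
    by apply/matrixP => k l; rewrite !mxE; ring.
  - by rewrite lexx ler01.
  - move=> t t01; apply: has_dot_innerW.
    apply: has_dotD; last first.
      apply: has_dotN; have := has_dotZ (has_dot_id t) (has_dot_cst a t).
      by rewrite scale1r scaler0 addr0.
    apply: has_dotD; first exact/has_dot_dsubmx/zd.
    apply: has_dotN; rewrite -dotx//; exact: (G_potential GP) xT t t01.
  - exact: cross_cont.
have fq : functional (f2 f1 A W) (y a b) =
    \int[lebesgue_measure]_(t in `[0, 1]) (f1 (q t) (dot q t) t + c).
  apply: eq_Rintegral => t; rewrite inE/= in_itv/= => t01.
  by rewrite /f2 -/(residual A _ _ t) residual_y// dot_yE// !col_mxKu.
have m01 : measurable (`[0, 1] : set (measurableTypeR R)) by exact: measurable_itv.
have int_cst : lebesgue_measure.-integrable `[0, 1] (EFin \o (fun=> c : R)).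
  exact/cont01_integrable/cont01_cst.
have int_shift w : trajectory w ->
    \int[lebesgue_measure]_(t in `[0, 1]) (f1 (w t) (dot w t) t + c) =
    functional f1 w + \int[lebesgue_measure]_(t in `[0, 1]) c.
  by move=> wT; apply: RintegralD => //; exact/cont01_integrable/f1_cont.
rewrite fq int_shift//.
apply: (@le_trans _ _ (functional f1 x + \int[lebesgue_measure]_(t in `[0, 1]) c)).
  by rewrite lerD2r; exact: qmin.
rewrite -int_shift// -[leLHS]addr0 -[X in _ + X <= _]cross0 -RintegralD//; last 2 first.
- exact/cont01_integrable/cont01D/cont01_cst.
- exact: cont01_integrable.
apply: le_Rintegral => //.
- apply: cont01_integrable; apply: cont01D => //; apply: cont01D => //.
  exact: cont01_cst.
- apply: cont01_integrable.
  apply: (@eq_cont01 _ _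
    (fun t => f1 (x t) (dot x t) t + 2^-1 * innerW W (u t) (u t))).
    by move=> t t01; rewrite dotx// -normsqW_inner.
  apply: cont01D => // t t01; apply: cvgM; first exact: cvg_cst.
  exact: (cont01_innerW (W := W) uc uc).
- move=> t; rewrite /= in_itv/= => t01.
  rewrite /f2 -/(residual A _ _ t) -/(x t) -/(u t) dotx// -addrA lerD2l.
  have := normsqW_tangent W_sym a (u t) Wpos.
  by rewrite /c; lra.
Qed.

End Potential.

(** * The two cases *)

Section ConstantField.
Context {R : realType} {N P : nat}.
Variables (A : 'cV[R]_N -> R -> 'M[R]_(P, N)) (q : R -> 'cV[R]_N).
Variable theta : 'cV[R]_P -> 'cV[R]_P -> R -> 'cV[R]_P.

Lemma const_potential (A0 : 'M[R]_(P, N)) :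
  (forall x t, 0 <= t <= 1 -> A x t = A0) ->
  (forall a b t, 0 <= t <= 1 -> theta a b t = theta_const A0 q a b t) ->
  exists G DA, potential_along A q theta G DA.
Proof.
move=> AE thetaE; exists (mulmx A0), (fun=> 0); split.
- move=> z /trajectoryP[zd _ _ _] t t01; rewrite AE//.
  have := has_dot_mulmx (has_dot_cst A0 t) (zd t t01).
  by rewrite mul0mx add0r.
- by move=> a b t t01; rewrite thetaE// /theta_const mulmxBr.
- move=> t t01; apply: (eq_has_dot (f := fun=> A0)) => //.
    by move=> s s01; rewrite AE.
  exact: has_dot_cst.
- exact: cont01_cst.
- move=> i t t01; exists 0; last by rewrite !mul0mx.
  by under eq_fun do rewrite !AE// subrr scaler0; exact: cvg_cst.
Qed.

End ConstantField.

Section ScalarField.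
Context {R : realType} {P : nat}.

(** The direction (e, 0) does not move t, so no increment leaves the domain and the
    derivative is two-sided even at t = 0 and t = 1. *)
Lemma C2_matrix_field_partial m n (A : 'cV[R]_n -> R -> 'M[R]_(m, n)) e :
  C2_matrix_field A -> exists2 D : 'cV[R]_n * R^o -> 'M[R]_(m, n),
    forall x t, 0 <= t <= 1 ->
      h^-1 *: (A (h *: e + x) t - A x t) @[h --> 0^'] --> D (x, t) &
    {within [set p : 'cV[R]_n * R^o | 0 <= p.2 <= 1], continuous D}.
Proof.
set S : set ('cV[R]_n * R^o) := [set p | 0 <= p.2 <= 1].
move=> [_ /(_ (e, 0))[Ad [Dc _]]].
exists (fun p => derive_in S (fun p => A p.1 p.2) p (e, 0)) => // x t t01.
have := Ad (x, t) t01; rewrite /derivable_in /derive_in.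
apply: cvg_trans => U; rewrite /quotient_in => SU.
have {}SU : \forall h \near 0^', S (h *: (e, 0 : R^o) + (x, t : R^o)) ->
   U (h^-1 *: (A (h *: e + x) (h *: (0 : R^o) + t) - A x t)) by exact: SU.
apply: filterS SU => h; rewrite /S/= scaler0 add0r; exact.
Qed.

(** Restriction to t = 0 turns regularity of a field on R x [0, 1] into regularity
    of a function of one real variable. *)
Lemma continuous_const_mx (V : topologicalType) (F : 'cV[R]_1 * R^o -> V) :
  {within [set p : 'cV[R]_1 * R^o | 0 <= p.2 <= 1], continuous F} ->
  continuous (fun r : R^o => F (const_mx r, 0)).
Proof.
move=> /subspace_continuousP Fc r.
have r01 : 0 <= (0 : R) <= 1 by rewrite lexx ler01.
apply: (cvg_comp (fun r : R^o => (const_mx r, 0 : R^o)) F _ (Fc (const_mx r, 0) r01)).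
have H1 : (const_mx s : 'cV[R]_1) @[s --> r] --> (const_mx r : 'cV[R]_1).
  by apply/cvg_mxP => i j; under eq_fun do rewrite mxE; rewrite mxE; exact: cvg_id.
have H := cvg_pair H1 (cvg_cst (0 : R^o)).
move=> U SU.
have {}SU : \forall s \near r, 0 <= (0 : R) <= 1 -> U (const_mx s, 0 : R^o).
  exact: H SU.
by apply: filterS SU => s /(_ r01).
Qed.

Variables (A : 'cV[R]_1 -> R -> 'M[R]_(P, 1)) (q : R -> 'cV[R]_1).
Variable theta : 'cV[R]_P -> 'cV[R]_P -> R -> 'cV[R]_P.

(** With a single position coordinate, A(x, t) = alpha(x) is a function of one
    variable, and every continuous function of one variable has an
    antiderivative. *)
Lemma scalar_potential (a1 : R -> 'cV[R]_P) :
  C2_matrix_field A -> trajectory q ->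
  (forall x t, 0 <= t <= 1 -> col ord0 (A x t) = a1 (x ord0 ord0)) ->
  (forall a b t, 0 <= t <= 1 -> theta a b t = theta_scalar ord0 a1 q a b t) ->
  exists G DA, potential_along A q theta G DA.
Proof.
move=> A_C2 qT Aa1 thetaE; have [qd [c qdd cc] qc qdc] := trajectoryP qT.
pose alpha r := A (const_mx r) 0.
have in0 : 0 <= (0 : R) <= 1 by rewrite lexx ler01.
have colE (B C : 'M[R]_(P, 1)) : col ord0 B = col ord0 C -> B = C.
  move=> BC; apply/matrixP => k j; rewrite ord1.
  by have /matrixP/(_ k ord0) := BC; rewrite !mxE.
have AE x t : 0 <= t <= 1 -> A x t = alpha (x ord0 ord0).
  by move=> t01; apply: colE; rewrite /alpha !Aa1// mxE.
have [D AD Dc] := C2_matrix_field_partial (ei ord0) A_C2.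
pose alpha' r := D (const_mx r, 0).
have alpha_d r : h^-1 *: (alpha (h + r) - alpha r) @[h --> 0^'] --> alpha' r.
  have := AD (const_mx r) 0 in0.
  by under eq_fun do rewrite !AE// !mxE !eqxx mulr1.
have alpha'_c : continuous (alpha' : R^o -> _) by exact: continuous_const_mx.
have alpha_c : continuous (alpha : R^o -> _).
  by have [Ac _] := A_C2; exact: continuous_const_mx Ac.
have qs : forall t, 0 <= t <= 1 ->
    has_dot (fun s => q s ord0 ord0 : R^o) t (dot q t ord0 ord0 : R^o).
  by move=> t t01; have /has_dot_mxP := qd t t01; exact.
have /choice[Phi PhiE] (k : 'I_P) : exists F : R -> R^o, forall r,
    h^-1 *: (F (h + r) - F r) @[h --> 0^'] --> (alpha r k ord0 : R^o).
  apply: (continuous_antiderivative (f := fun r => alpha r k ord0)) => r.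
  by have /cvg_mxP := alpha_c r; exact.
pose G (x : 'cV[R]_1) : 'cV[R]_P := \col_k Phi k (x ord0 ord0).
have G_pot z : trajectory z -> forall t, 0 <= t <= 1 ->
    has_dot (G \o z) t (A (z t) t *m dot z t).
  move=> /trajectoryP[zd _ _ _] t t01; apply/has_dot_mxP => k j.
  rewrite ord1 mxE big_ord1 AE// mulrC.
  have zs : has_dot (fun s => z s ord0 ord0 : R^o) t (dot z t ord0 ord0 : R^o).
    by have /has_dot_mxP := zd t t01; exact.
  have := has_dot_comp (PhiE k (z t ord0 ord0)) zs.
  by under [fun s => (G \o z) s k ord0]eq_fun do rewrite /= mxE.
exists G, (fun t => dot q t ord0 ord0 *: alpha' (q t ord0 ord0)); split.
- exact: G_pot.
- move=> a b t t01; rewrite thetaE// /theta_scalar; congr (_ + _).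
  apply/matrixP => k j; rewrite (ord1 j) [LHS]mxE.
  have Gk s : 0 <= s <= 1 -> has_dot (fun s => G (q s) k ord0 : R^o) s
      ((A (q s) s *m dot q s) k ord0 : R^o).
    by move=> s01; have /has_dot_mxP := G_pot q qT s s01; exact.
  have gc : cont01 (fun s => (A (q s) s *m dot q s) k ord0 : R^o).
    by have /cont01_mxP := cont01_mulmx (A_cont A_C2 qT) qdc; exact.
  have -> : (G (q t) - G (q 0)) k ord0 = G (q t) k ord0 - G (q 0) k ord0.
    by move: (G (q t)) (G (q 0)) => u v; rewrite !mxE.
  rewrite -(Rintegral_has_dot t01 Gk gc).
  apply: eq_Rintegral => s; rewrite inE/= in_itv/= => /andP[s0 st].
  have s01 : 0 <= s <= 1 by move: t01 => /andP[_ t1]; rewrite s0 (le_trans st).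
  by rewrite -(Aa1 _ s)// !mxE big_ord1 mulrC.
- move=> t t01; apply: (eq_has_dot (f := alpha \o (fun s => q s ord0 ord0))) => //.
    by move=> s s01; rewrite AE.
  exact: has_dot_comp (alpha_d _) (qs t t01).
- move=> t t01; apply: cvgZ.
    by have /cvg_mxP := qdc t t01; exact.
  have := qc t t01 => /cvg_mxP/(_ ord0 ord0) qtc.
  exact: (cvg_comp _ _ qtc (alpha'_c _)).
- move=> i t t01; exists (alpha' (q t ord0 ord0)).
    have -> : (fun h : R => h^-1 *: (A (h *: ei i + q t) t - A (q t) t)) =
        fun h => h^-1 *: (alpha (h + q t ord0 ord0) - alpha (q t ord0 ord0)).
      by apply/funext => h; rewrite (ord1 i) !AE// !mxE !eqxx mulr1.
    exact: alpha_d.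
  apply/matrixP => k j.
  by rewrite (ord1 i) (ord1 j) !mxE !big_ord1 !mxE !eqxx mulr1 mulrC.
Qed.

End ScalarField.

Theorem theorem3p2 (R : realType) (N P : nat)
    (f1 : 'cV[R]_N -> 'cV[R]_N -> R -> R)
    (A : 'cV[R]_N -> R -> 'M[R]_(P, N)) (W : 'M[R]_P)
    (q : R -> 'cV[R]_N) (theta : 'cV[R]_P -> 'cV[R]_P -> R -> 'cV[R]_P)
    (hf1 : C2_lagrangian f1) (hA : C2_matrix_field A) (hW : sym_posdef W)
    (hEL : euler_lagrange f1 q) (hmin : global_minimizer f1 q)
    (hcase :
      (exists A0 : 'M[R]_(P, N),
         (forall x t, 0 <= t <= 1 -> A x t = A0) /\
         (forall a b t, 0 <= t <= 1 -> theta a b t = theta_const A0 q a b t))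
      \/
      (N = 1%N /\ exists (i : 'I_N) (a1 : R -> 'cV[R]_P),
         (forall x t, 0 <= t <= 1 -> col i (A x t) = a1 (x i ord0)) /\
         (forall a b t, 0 <= t <= 1 ->
            theta a b t = theta_scalar i a1 q a b t))) :
  [/\ forall a b : 'cV[R]_P,
        euler_lagrange (f2 f1 A W) (fun t => col_mx (q t) (theta a b t)),
      forall theta0 theta1 : 'cV[R]_P, exists a b : 'cV[R]_P,
        theta a b 0 = theta0 /\ theta a b 1 = theta1
    & forall a b : 'cV[R]_P,
        global_minimizer (f2 f1 A W)
          (fun t => col_mx (q t) (theta a b t))].
Proof.
have qT : trajectory q by case: hmin.
have [G [DA GP]] : exists G DA, potential_along A q theta G DA.
  case: hcase => [[A0 [AE thE]]|[N1 [i [a1 [AE thE]]]]].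
    exact: const_potential AE thE.
  subst N; move: AE thE; rewrite (ord1 i) => AE thE.
  exact: scalar_potential hA qT AE thE.
split.
- by move=> a b; exact: (f2_euler_lagrange hW qT GP).
- exact: theta_endpoints GP.
- by move=> a b; exact: (f2_global_minimizer hW qT GP).
Qed.
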